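(* Let $V$ be a finite dimensional graded vector space over a field of characteristic $0$, and suppose $\{\ ,\ \}$ is a Pinczon bracket on the space $\mathcal C(V)$ of cyclic multilinear forms on $V[1]$. Then the space $\mathcal C_{vsp}(V)$ of cyclic multilinear forms on $V[1]$ vanishing on shuffle products is a Lie subalgebra of $(\mathcal C(V),\{\ ,\ \})$.
   Context: Grading and signs. $|x|$ is the degree of a homogeneous $x\in V$; $V[1]$ is the same space with degree $\deg(x)=|x|-1$. Multilinear forms on $V[1]$ are graded with scalars in degree $0$. Koszul's sign rule is used everywhere: each term in which graded letters appear in an order differing from that of the first term by a permutation $\sigma$ carries the implicit sign of $\sigma$ computed by taking into account only the letters of odd degree (for $\deg$). Cyclic forms. An $n$-linear form $\Omega$ on $V[1]$ is cyclic if $\Omega(x_n,x_1,\ldots,x_{n-1})=\Omega(x_1,\ldots,x_n)$ (Koszul sign). $\mathcal C^n$ is the space of $n$-linear cyclic forms, $\mathcal C^0=\mathbb K$, $\mathcal C(V)=\bigoplus_n\mathcal C^n$. For an $n$-linear form, $\Omega^{Cycl}=\sum_\tau\Omega^\tau$, the sum over the subgroup of $\mathfrak S_n$ generated by $(1,2,\ldots,n)$, with $\Omega^\tau(x_1,\ldots,x_n)=\Omega(x_{\tau^{-1}(1)},\ldots,x_{\tau^{-1}(n)})$. Pinczon bracket. A Pinczon bracket on $\mathcal C(V)$ is a bilinear map $\{\ ,\ \}$ such that: (1) $\{\mathcal C^{k+1},\mathcal C^{k'+1}\}\subset\mathcal C^{k+k'}$; (2) it is a graded Lie bracket on $\mathcal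 C(V)$ (antisymmetry and Jacobi with Koszul signs); (3) $\{\alpha,(\beta_1\otimes\cdots\otimes\beta_k)^{Cycl}\}=\sum_j\{\alpha,\beta_j\}(\beta_1\otimes\cdots\hat{\beta_j}\cdots\otimes\beta_k)^{Cycl}$ for linear forms $\alpha,\beta_j$; (4) $\{\Omega,\mathcal C(V)\}=0$ iff $\Omega\in\mathcal C^0$. Pinczon brackets correspond bijectively to degree $0$, symmetric, non degenerate bilinear forms $b$ on $V$ through $\{\Omega,\Omega'\}=\sum_i(\iota_{e_i}\Omega\otimes\iota_{e'_i}\Omega')^{Cycl}$, where $(e_i)$ is a basis of $V$, $b(e_i,e'_j)=\delta_{ij}$, and $\iota_x$ is insertion of $x$ in one slot. Shuffles. $Sh(p,q)$ is the set of $\sigma\in\mathfrak S_{p+q}$ with $\sigma(1)<\cdots<\sigma(p)$ and $\sigma(p+1)<\cdots<\sigma(p+q)$, and $sh_{p,q}(x_1\otimes\cdots\otimes x_p,x_{p+1}\otimes\cdots\otimes x_{p+q})=\sum_{\sigma\in Sh(p,q)}x_{\sigma^{-1}(1)}\otimes\cdots\otimes x_{\sigma^{-1}(p+q)}$ (Koszul signs). A $k$-linear map on $V[1]$ vanishes on shuffle products if it vanishes on the image of $sh_{p,k-p}$ for all $0<p<k$. A $(k+1)$-linear cyclic form $\Omega$ vanishes on shuffle products if for every $y$ the map $(x_1,\ldots,x_k)\mapsto\Omega(x_1,\ldots,x_k,y)$ vanishes on shuffle products.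
   Formalization: The bracket is assumed to be given by the formula attached to a degree 0, graded symmetric, non degenerate form b, and condition (4) is required only for forms of arity at most 1, since brackets of that formula have central elements outside C^0 (e.g. in C^4 when dim V is at least 2). *)

(* Defs.v *)
From HB Require Import structures.
From mathcomp Require Import all_boot all_order all_fingroup all_algebra.
From mathcomp Require Import sesquilinear.

Set Implicit Arguments.
Unset Strict Implicit.
Unset Printing Implicit Defensive.

Import GRing.Theory.

Local Open Scope ring_scope.

Section CyclicForms.

Variables (K : fieldType) (V : vectType K) (gr : int -> {vspace V}).

(* [gr i] is the subspace of elements of degree i; V is finite dimensional, so
   all but finitely many of them vanish. *)
Definition is_grading : Prop :=
  exists s : seq int,
    [/\ uniq s, forall i, i \notin s -> gr i = 0%VS,
        directv (\sum_(i <- s) gr i) & (\sum_(i <- s) gr i = fullv)%VS].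

(* A family (Omega_n)_n of functions V^n -> K, Omega_n being the restriction of
   Omega to the sequences of size n.  Forms are compared pointwise. *)
Definition mform : Type := seq V -> K.

(* A letter is a vector x together with its degree |x| in V; Koszul signs are
   computed with its degree |x| - 1 in V[1].  Signed identities are stated on
   homogeneous letters, which determine multilinear forms. *)
Definition letter : Type := (int * V)%type.

Definition homogeneous (w : seq letter) : bool :=
  all (fun l => l.2 \in gr l.1) w.

Definition sdeg (l : letter) : int := l.1 - 1.

Definition sgn2 (p q : int) : K := (-1) ^+ (odd `|p|%N && odd `|q|%N).

Definition ksign (w : seq letter) (sigma : 'S_(size w)) : K :=
  \prod_(i < size w) \prod_(j < size w | (i < j)%N && (sigma j < sigma i)%N)
    sgn2 (sdeg (tnth (in_tuple w) i)) (sdeg (tnth (in_tuple w) j)).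

(* x_1 ... x_n  |->  x_{sigma^-1(1)} ... x_{sigma^-1(n)} *)
Definition permute (w : seq letter) (sigma : 'S_(size w)) : seq letter :=
  [seq tnth (in_tuple w) ((sigma^-1)%g i) | i : 'I_(size w)].

Definition koszul_act (Omega : mform) (w : seq letter) (sigma : 'S_(size w)) : K :=
  ksign sigma * Omega (unzip2 (permute sigma)).

(* The cycle (1,2,...,n), i |-> i + 1 mod n. *)
Definition ncycle (n : nat) : 'S_n := perm (@ordS_inj n).

Definition cycl (Omega : mform) (w : seq letter) : K :=
  \sum_(tau in <[ncycle (size w)]>%g) koszul_act Omega tau.

Definition multilinear (Omega : mform) : Prop :=
  forall (s1 s2 : seq V) (a : K) (x y : V),
    Omega (s1 ++ (a *: x + y) :: s2)
    = a * Omega (s1 ++ x :: s2) + Omega (s1 ++ y :: s2).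

Definition is_cyclic (Omega : mform) : Prop :=
  forall w, homogeneous w -> koszul_act Omega (ncycle (size w)) = Omega (unzip2 w).

(* C(V), the direct sum of the spaces C^n. *)
Record cyclic_form (Omega : mform) : Prop := CyclicForm {
  cf_multilinear : multilinear Omega;
  cf_cyclic : is_cyclic Omega;
  cf_finite : exists N : nat, forall s, (N < size s)%N -> Omega s = 0 }.

(* C^n *)
Definition cyclic_nform (n : nat) (Omega : mform) : Prop :=
  cyclic_form Omega /\ (forall s, size s != n -> Omega s = 0).

(* Omega has degree p as a map from tensors on V[1] to scalars of degree 0. *)
Definition form_degree (p : int) (Omega : mform) : Prop :=
  forall w, homogeneous w -> Omega (unzip2 w) != 0 ->
    \sum_(l <- w) sdeg l + p = 0.

Definition lincomb (a : K) (Omega Omega' : mform) : mform :=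
  fun s => a * Omega s + Omega' s.

(* The tensor product of families; the product of C^p and C^q only contributes
   to sequences of size p + q. *)
Definition tensor (Omega Omega' : mform) : mform :=
  fun s => \sum_(k < (size s).+1) Omega (take k s) * Omega' (drop k s).

Definition tensors (Omegas : seq mform) : mform :=
  foldr tensor (fun s => (nilp s)%:R) Omegas.

Definition insert_last (x : V) (Omega : mform) : mform :=
  fun s => Omega (rcons s x).

Definition insert_first (x : V) (Omega : mform) : mform :=
  fun s => Omega (x :: s).

(* b is homogeneous of degree 0, symmetric in the graded sense for the degree of
   V (so symmetric in the usual sense on V_0), and non degenerate. *)
Record quadratic_form (b : {biscalar V}) : Prop := QuadraticForm {
  qf_degree0 : forall i j x y, x \in gr i -> y \in gr j ->
    i + j != 0 -> b x y = 0;
  qf_symmetric : forall i j x y, x \in gr i -> y \in gr j ->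
    b x y = sgn2 i j * b y x;
  qf_nondegenerate : forall x, (forall y, b x y = 0) -> x = 0 }.

(* {Omega, Omega'} = \sum_i (i_{e_i} Omega (x) i_{e'_i} Omega')^Cycl.  Inserting
   e_i last and e'_i first makes them adjacent; as deg e_i + deg e'_i = -2 is
   even, they then contribute no sign. *)
Definition bracket_of_form (b : {biscalar V}) (br : mform -> mform -> mform) : Prop :=
  exists e e' : (\dim {:V}).-tuple V,
    [/\ basis_of {:V} e,
        forall i j, b (tnth e i) (tnth e' j) = (i == j)%:R
      & forall Omega Omega', cyclic_form Omega -> cyclic_form Omega' ->
        forall w, homogeneous w ->
          br Omega Omega' (unzip2 w)
          = cycl (fun s => \sum_i tensor (insert_last (tnth e i) Omega)
                                         (insert_first (tnth e' i) Omega') s) w].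

(* The values of [br] outside C(V) are irrelevant.
   [pb_center], the condition that the center is C^0, is required of the forms
   with components of arity at most 1 only, where it says that the pairing of
   linear forms is non degenerate.  On all of C(V) it fails for the brackets of
   [bracket_of_form] as soon as dim V >= 2: if u(x, y) = (-1)^(deg x) b(x, y),
   then (u (x) u)^Cycl, of arity 4, is central and non zero.
   Nor do the other conditions force the shape of [bracket_of_form]: they are
   preserved by transport along linear automorphisms T of C(V) that respect arity
   and degree, commute with all {alpha, .}, alpha linear, and are the identity
   in arity at most 1. *)
Record pinczon_bracket (br : mform -> mform -> mform) : Prop := PinczonBracket {
  pb_closed : forall Omega Omega',
    cyclic_form Omega -> cyclic_form Omega' -> cyclic_form (br Omega Omega');
  pb_linearl : forall a Omega1 Omega2 Omega',
    cyclic_form Omega1 -> cyclic_form Omega2 -> cyclic_form Omega' ->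
    br (lincomb a Omega1 Omega2) Omega'
    =1 lincomb a (br Omega1 Omega') (br Omega2 Omega');
  pb_linearr : forall a Omega Omega1 Omega2,
    cyclic_form Omega -> cyclic_form Omega1 -> cyclic_form Omega2 ->
    br Omega (lincomb a Omega1 Omega2)
    =1 lincomb a (br Omega Omega1) (br Omega Omega2);
  pb_arity : forall k k' Omega Omega',
    cyclic_nform k.+1 Omega -> cyclic_nform k'.+1 Omega' ->
    cyclic_nform (k + k') (br Omega Omega');
  pb_antisym : forall p p' Omega Omega',
    cyclic_form Omega -> cyclic_form Omega' ->
    form_degree p Omega -> form_degree p' Omega' ->
    forall s, br Omega Omega' s = - (sgn2 p p' * br Omega' Omega s);
  pb_jacobi : forall p p' Omega Omega' Omega'',
    cyclic_form Omega -> cyclic_form Omega' -> cyclic_form Omega'' ->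
    form_degree p Omega -> form_degree p' Omega' ->
    forall s, br Omega (br Omega' Omega'') s
              = br (br Omega Omega') Omega'' s
                + sgn2 p p' * br Omega' (br Omega Omega'') s;
  pb_linear_form : forall k alpha (beta : 'I_k -> mform) (p : 'I_k -> int) Omega,
    cyclic_nform 1 alpha ->
    (forall j, cyclic_nform 1 (beta j) /\ form_degree (p j) (beta j)) ->
    cyclic_nform k Omega ->
    (forall w, homogeneous w ->
       Omega (unzip2 w) = cycl (tensors [seq beta i | i : 'I_k]) w) ->
    forall w, homogeneous w ->
      br alpha Omega (unzip2 w)
      = \sum_(j < k) (\prod_(i < k | (i < j)%N) sgn2 (p i) (p j))
          * br alpha (beta j) [::]
          * cycl (tensors [seq beta i | i <- enum 'I_k & i != j]) w;
  pb_center : forall Omega,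
    cyclic_form Omega -> (forall s, (1 < size s)%N -> Omega s = 0) ->
    ((forall Omega', cyclic_form Omega' -> br Omega Omega' =1 fun=> 0)
     <-> cyclic_nform 0 Omega) }.

(* sigma(1) < ... < sigma(p) and sigma(p+1) < ... < sigma(n) *)
Definition shuffles (p n : nat) : {set 'S_n} :=
  [set sigma : 'S_n | [forall i : 'I_n, forall j : 'I_n,
     (i < j)%N && ((j < p)%N || (p <= i)%N) ==> (sigma i < sigma j)%N]].

Definition vanishes_on_shuffles (Omega : mform) : Prop :=
  forall (w : seq letter) (y : V) (p : nat), homogeneous w -> (0 < p < size w)%N ->
    \sum_(sigma in shuffles p (size w))
      koszul_act (insert_last y Omega) sigma = 0.

(* C_vsp(V).  The condition on shuffles is empty in arity at most 2. *)
Definition vsp_form (Omega : mform) : Prop :=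
  cyclic_form Omega /\ vanishes_on_shuffles Omega.

Record lie_subalgebra (br : mform -> mform -> mform) (P : mform -> Prop) : Prop :=
  LieSubalgebra {
    ls_sub : forall Omega, P Omega -> cyclic_form Omega;
    ls_zero : P (fun=> 0);
    ls_lincomb : forall a Omega Omega',
      P Omega -> P Omega' -> P (lincomb a Omega Omega');
    ls_bracket : forall Omega Omega', P Omega -> P Omega' -> P (br Omega Omega') }.

End CyclicForms.

(* Main.v *)
From HB Require Import structures.
Require Import Defs.
From mathcomp Require Import all_boot all_order all_fingroup all_algebra.
From mathcomp Require Import sesquilinear.
From mathcomp Require Import ring zify.

(* Sum {Omega, Omega'}(x_1, ..., x_n, y) over the rotations of x_1 ... x_n y.  A
   rotation breaks into two adjacent factors, fed to Omega and Omega', and y lies in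
   one of them; cyclicity of the form that receives y brings y back to the last
   place.  With x_1 ... x_n = u v v', the terms become, up to sign,
   F(u, e, v') c(v), where F is one of the forms with last argument y, and c the
   other one with last argument the basis vector dual to e.
   Such an insertion vanishes on a shuffle product of a and b.  Indeed, shuffles
   commute with deconcatenation, so that u, v and v' are shuffles of subwords of a
   and of b: if v is a proper shuffle, c kills it; if v is a non-empty subword of a,
   the sum over the rest is F on the shuffle of b with a where v is replaced by e,
   and symmetrically in b; if v is empty, it is F on the shuffle of e, a and b.
   The bases of the bracket need not be homogeneous, but only the homogeneous
   components of opposite degrees of sum_i e_i (x) e'_i are non zero. *)

Set Implicit Arguments.
Unset Strict Implicit.
Unset Printing Implicit Defensive.

Import GRing.Theory.

Local Open Scope ring_scope.

(** * Signed shuffles as functionals *)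

Section SignedWords.

Variables (K : fieldType) (T : eqType) (par : pred T).

Implicit Types (a b u v w : seq T) (x y l : T) (F : seq T -> K).

Definition wpar w : bool := odd (count par w).

(** The Koszul sign for exchanging the adjacent words [u] and [v]. *)
Definition sg u v : K := (-1) ^+ (wpar u && wpar v).

Lemma wpar_nil : wpar [::] = false. Proof. by []. Qed.

Lemma wpar_cons x w : wpar (x :: w) = par x (+) wpar w.
Proof. by rewrite /wpar /= oddD oddb. Qed.

Lemma wpar_cat u v : wpar (u ++ v) = wpar u (+) wpar v.
Proof. by rewrite /wpar count_cat oddD. Qed.

Lemma wpar_perm u v : perm_eq u v -> wpar u = wpar v.
Proof. by move=> /seq.permP e; rewrite /wpar e. Qed.

Lemma sg0w u : sg [::] u = 1. Proof. by []. Qed.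

Lemma sgw0 u : sg u [::] = 1. Proof. by rewrite /sg wpar_nil andbF. Qed.

Lemma sgC u v : sg u v = sg v u. Proof. by rewrite /sg andbC. Qed.

Lemma sg_catl u v w : sg (u ++ v) w = sg u w * sg v w.
Proof. by rewrite /sg wpar_cat -signr_addb -andb_addl. Qed.

Lemma sg_catr u v w : sg w (u ++ v) = sg w u * sg w v.
Proof. by rewrite sgC sg_catl !(sgC w). Qed.

Lemma sg_consl x v w : sg (x :: v) w = sg [:: x] w * sg v w.
Proof. exact: (sg_catl [:: x]). Qed.

Lemma sg_consr x v w : sg w (x :: v) = sg w [:: x] * sg w v.
Proof. exact: (sg_catr [:: x]). Qed.

Lemma sg_sq u v : sg u v * sg u v = 1.
Proof. by rewrite /sg -signr_addb addbb. Qed.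

(* The value of F, extended linearly, at the signed shuffle product of a and b. *)
Fixpoint shuf a : seq T -> (seq T -> K) -> K :=
  if a is x :: a' then
    fix shuf_a b F :=
      if b is y :: b' then
        shuf a' b (fun w => F (x :: w)) + sg [:: y] a * shuf_a b' (fun w => F (y :: w))
      else F a
  else fun b F => F b.

(** The deconcatenation coproduct of [w], fed to [G]. *)
Fixpoint splits w (G : seq T -> seq T -> K) : K :=
  if w is x :: w' then G [::] w + splits w' (fun u v => G (x :: u) v)
  else G [::] [::].

#[global] Arguments shuf : simpl never.

Lemma shuf0w b F : shuf [::] b F = F b. Proof. by []. Qed.

Lemma splits_cons x w G :
  splits (x :: w) G = G [::] (x :: w) + splits w (fun u v => G (x :: u) v).
Proof. by []. Qed.

Lemma shufw0 a F : shuf a [::] F = F a. Proof. by case: a. Qed.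

Lemma shuf_cons x a y b F :
  shuf (x :: a) (y :: b) F = shuf a (y :: b) (fun w => F (x :: w))
    + sg [:: y] (x :: a) * shuf (x :: a) b (fun w => F (y :: w)).
Proof. by []. Qed.

Lemma eq_shuf a b F F' :
  (forall w, perm_eq w (a ++ b) -> F w = F' w) -> shuf a b F = shuf a b F'.
Proof.
elim: a b F F' => [|x a IHa] b F F' eqF; first by rewrite !shuf0w eqF.
elim: b F F' eqF => [|y b IHb] F F' eqF.
  by rewrite !shufw0 eqF // cats0.
rewrite !shuf_cons; congr (_ + _ * _).
  by apply: IHa => w pw; apply: eqF; rewrite cat_cons perm_cons.
apply: IHb => w pw; apply: eqF.
by rewrite -[y :: b]cat1s perm_sym perm_catCA cat1s perm_cons perm_sym.
Qed.

Lemma shufD a b F F' :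
  shuf a b (fun w => F w + F' w) = shuf a b F + shuf a b F'.
Proof.
elim: a b F F' => [|x a IHa] b F F' //.
elim: b F F' => [|y b IHb] F F' //.
by rewrite !shuf_cons IHa IHb mulrDr addrACA.
Qed.

Lemma shufZ a b k F : shuf a b (fun w => k * F w) = k * shuf a b F.
Proof.
elim: a b F => [|x a IHa] b F //.
elim: b F => [|y b IHb] F //.
by rewrite !shuf_cons IHa IHb mulrDr mulrCA.
Qed.

Lemma shuf0 a b : shuf a b (fun=> 0) = 0.
Proof.
rewrite -[RHS](mul0r (shuf a b (fun=> 0))) -shufZ.
by apply: eq_shuf => w _; rewrite mul0r.
Qed.

Lemma shuf_sum I r (P : pred I) a b (F : I -> seq T -> K) :
  shuf a b (fun w => \sum_(i <- r | P i) F i w) = \sum_(i <- r | P i) shuf a b (F i).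
Proof.
elim: r => [|i r IHr].
  by rewrite big_nil -[RHS](shuf0 a b); apply: eq_shuf => w _; rewrite big_nil.
rewrite big_cons -IHr.
case Pi: (P i); last by apply: eq_shuf => w _; rewrite big_cons Pi.
by rewrite -shufD; apply: eq_shuf => w _; rewrite big_cons Pi.
Qed.

(** Parity is invariant under rearrangement, so a coefficient that sees only the parity of the word
    comes out of the shuffle. *)
Lemma shuf_par (h : bool -> K) a b F :
  shuf a b (fun w => h (wpar w) * F w) = h (wpar (a ++ b)) * shuf a b F.
Proof. by rewrite -shufZ; apply: eq_shuf => w /wpar_perm ->. Qed.

Lemma shufC a b F : shuf a b F = sg a b * shuf b a F.
Proof.
elim: a b F => [|x a IHa] b F; first by rewrite shufw0 sg0w mul1r.
elim: b F => [|y b IHb] F; first by rewrite shufw0 sgw0 mul1r.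
rewrite !shuf_cons IHa IHb mulrDr addrC; congr (_ + _); rewrite mulrA.
  by rewrite [in RHS]sg_consr (sgC [:: y]).
congr (_ * _).
by rewrite [sg (x :: a) _]sg_consl mulrAC sg_sq mul1r.
Qed.

Lemma eq_splits w G G' :
  (forall u v, u ++ v = w -> G u v = G' u v) -> splits w G = splits w G'.
Proof.
elim: w G G' => [|x w IHw] G G' eqG /=; first by rewrite eqG.
by rewrite eqG //; congr (_ + _); apply: IHw => u v e; rewrite eqG //= e.
Qed.

Lemma splitsD w G G' :
  splits w (fun u v => G u v + G' u v) = splits w G + splits w G'.
Proof. by elim: w G G' => [|x w IHw] G G' //=; rewrite IHw addrACA. Qed.

Lemma splitsZ w k G : splits w (fun u v => k * G u v) = k * splits w G.
Proof. by elim: w G => [|x w IHw] G //=; rewrite IHw mulrDr. Qed.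

Lemma splits0 w : splits w (fun _ _ => 0) = 0.
Proof. by elim: w => [|x w IHw] //=; rewrite IHw addr0. Qed.

Lemma splits_nseq w G : splits w G = \sum_(k < (size w).+1) G (take k w) (drop k w).
Proof.
elim: w G => [|x w IHw] G /=; first by rewrite big_ord1.
by rewrite big_ord_recl IHw.
Qed.

Lemma splits_sum I r (P : pred I) w (G : I -> seq T -> seq T -> K) :
  splits w (fun u v => \sum_(i <- r | P i) G i u v) = \sum_(i <- r | P i) splits w (G i).
Proof.
by rewrite splits_nseq exchange_big; apply: eq_bigr => i _; rewrite splits_nseq.
Qed.

Lemma splits_exchange w w' (G : seq T -> seq T -> seq T -> seq T -> K) :
  splits w (fun u v => splits w' (G u v))
  = splits w' (fun u' v' => splits w (fun u v => G u v u' v')).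
Proof.
rewrite splits_nseq; under eq_bigr do rewrite splits_nseq.
by rewrite exchange_big splits_nseq; under [RHS]eq_bigr do rewrite splits_nseq.
Qed.

Lemma splits_shuf w a b (G : seq T -> seq T -> seq T -> K) :
  splits w (fun u v => shuf a b (G u v))
  = shuf a b (fun s => splits w (fun u v => G u v s)).
Proof.
rewrite splits_nseq -shuf_sum; apply: eq_shuf => s _.
by rewrite splits_nseq.
Qed.

Lemma splits_assoc w (G : seq T -> seq T -> seq T -> K) :
  splits w (fun s v => splits s (fun u a => G u a v))
  = splits w (fun u s => splits s (G u)).
Proof.
elim: w G => [|x w IHw] G //=.
by rewrite splitsD IHw addrA.
Qed.

Lemma splits_cat w x w' G :
  splits (w ++ x :: w') G = splits w (fun u v => G u (v ++ x :: w'))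
                            + splits w' (fun u v => G (w ++ x :: u) v).
Proof. by elim: w G => [|y w IHw] G //=; rewrite IHw addrA. Qed.

(** Compatibility of the two structures of the shuffle bialgebra: both halves of a cut are shuffles,
    and the sign comes from moving [b1] in front of [a2]. *)
Lemma shuf_splits a b (G : seq T -> seq T -> K) :
  shuf a b (fun w => splits w G)
  = splits a (fun a1 a2 => splits b (fun b1 b2 =>
      sg a2 b1 * shuf a1 b1 (fun u => shuf a2 b2 (G u)))).
Proof.
elim: a b G => [|x a IHa] b G.
  by apply: eq_splits => u v _; rewrite sg0w mul1r.
elim: b G => [|y b IHb] G.
  rewrite shufw0; apply: eq_splits => u v _ /=.
  by rewrite sgw0 mul1r !shufw0.
have eqx : shuf a (y :: b) (fun w => splits (x :: w) G)
  = shuf a (y :: b) (fun w => G [::] (x :: w))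
    + splits a (fun a1 a2 => splits (y :: b) (fun b1 b2 =>
        sg a2 b1 * shuf a1 b1 (fun u => shuf a2 b2 (G (x :: u))))).
  by rewrite -(IHa _ (fun u => G (x :: u))) -shufD.
have eqy : shuf (x :: a) b (fun w => splits (y :: w) G)
  = shuf (x :: a) b (fun w => G [::] (y :: w))
    + splits (x :: a) (fun a1 a2 => splits b (fun b1 b2 =>
        sg a2 b1 * shuf a1 b1 (fun u => shuf a2 b2 (G (y :: u))))).
  by rewrite -(IHb (fun u => G (y :: u))) -shufD.
(* The two terms with an empty left half recombine into the case where [a1] and [b1] are both
   empty. *)
rewrite shuf_cons eqx eqy mulrDr addrACA -shuf_cons !splits_cons sgw0 mul1r shuf0w.
rewrite -[RHS]addrA; congr (_ + _); rewrite mulrDr addrCA; congr (_ + _).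
  rewrite -splitsZ; apply: eq_splits => u v _.
  by rewrite shuf0w [in RHS]sg_consr mulrA (sgC [:: y]).
(* There remain the cuts where [a1] begins with [x]; if [b1] also begins with [y], both recursive
   calls contribute. *)
rewrite -splitsZ -splitsD; apply: eq_splits => a1 a2 a12.
rewrite !splits_cons -addrA; congr (_ + _); first by rewrite !shufw0.
rewrite -splitsZ -splitsD; apply: eq_splits => b1 b2 _.
rewrite shuf_cons mulrDr; congr (_ + _); rewrite !mulrA; congr (_ * _).
rewrite -a12 -cat_cons [in LHS]sg_catr (sg_consr y b1) (sgC a2 [:: y]).
ring.
Qed.

(** The place of [l] in a shuffle cuts [b] into [b1], before it, and [b2], after it; the sign moves
    [b1] across [l :: a']. *)
Lemma shuf_insert a l a' b F :
  shuf (a ++ l :: a') b F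
  = splits b (fun b1 b2 => sg b1 (l :: a') *
      shuf a b1 (fun u => shuf a' b2 (fun v => F (u ++ l :: v)))).
Proof.
elim: a b F => [|x a IHa] b F.
  elim: b F => [|y b IHb] F; first by rewrite /= sg0w mul1r !shufw0.
  rewrite cat0s shuf_cons splits_cons sg0w mul1r; congr (_ + _).
  rewrite IHb -splitsZ; apply: eq_splits => u v _.
  by rewrite mulrA -sg_consl.
elim: b F => [|y b IHb] F; first by rewrite /= sg0w mul1r !shufw0.
rewrite cat_cons shuf_cons splits_cons IHa -cat_cons IHb splits_cons.
rewrite sg0w !mul1r !shufw0 -addrA; congr (_ + _).
rewrite -splitsZ -splitsD; apply: eq_splits => b1 b2 _.
rewrite shuf_cons mulrDr; congr (_ + _); rewrite !mulrA; congr (_ * _).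
by rewrite sg_catr (sg_consl y b1); ring.
Qed.

(** The left half [u] is a shuffle of a prefix of [a] with a prefix of [b], which [c] kills unless
    exactly one of them is non-empty. A prefix of [b] must then cross all of [a], whence
    [sg a u]. *)
Lemma shuf_prefix (hom : pred T) (c H : seq T -> K) a b :
  (forall a b, a != [::] -> b != [::] -> all hom (a ++ b) -> shuf a b c = 0) ->
  c [::] = 0 -> all hom (a ++ b) ->
  shuf a b (fun s => splits s (fun u v => c u * H v))
  = splits a (fun u v => c u * shuf v b H)
    + splits b (fun u v => sg a u * (c u * shuf a v H)).
Proof.
move=> shuf_c c0 hom_ab.
rewrite shuf_splits.
case: a hom_ab => [|x a] hom_ab.
  rewrite /= c0 mul0r add0r; apply: eq_splits => u v _.
  by rewrite !sg0w !mul1r.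
rewrite !splits_cons c0 mul0r add0r addrC; congr (_ + _).
  apply: eq_splits => u v uv.
  case: b hom_ab => [|y b] hom_ab.
    by rewrite /= sgw0 mul1r !shufw0.
  rewrite splits_cons sgw0 mul1r shufw0.
  rewrite (@eq_splits _ _ (fun _ _ => 0)) ?splits0 ?addr0 ?shufZ //.
  move=> b1 b2 b12.
  rewrite (@eq_shuf _ _ _ (fun u => shuf v b2 H * c u)); last first.
    by move=> w _; rewrite shufZ mulrC.
  rewrite shufZ shuf_c ?mulr0 //.
  move: hom_ab; rewrite -b12 -uv /= !all_cat /= !all_cat.
  by case/and3P=> -> /andP[-> _] /and3P[-> -> _].
apply: eq_splits => u v _.
by rewrite shuf0w shufZ.
Qed.

Section Insertion.

Variables (hom : pred T) (l : T) (c F : seq T -> K).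

Hypothesis hom_l : hom l.

Hypothesis shuf_c : forall a b, a != [::] -> b != [::] -> all hom (a ++ b) ->
  shuf a b c = 0.

Hypothesis shuf_F : forall a b, a != [::] -> b != [::] -> all hom (a ++ b) ->
  shuf a b F = 0.

(* As a form, c has the degree of l minus that of its arguments, whence the sign
   for moving it past u. *)
Definition insertion w : K :=
  splits w (fun u s => splits s (fun v v' => sg u (l :: v) * c v * F (u ++ l :: v'))).

(** The argument of [c] comes from one of [a], [b] alone. Once the cuts of that word are fixed, the
    sum over the cuts of the other one is a shuffle under [F], with [l] in place of the argument of
    [c]. *)
Lemma shuf_insertion_pos a b : c [::] = 0 -> a != [::] -> b != [::] ->
  all hom (a ++ b) -> shuf a b insertion = 0.
Proof.
move=> c0 a0 b0 hom_ab.
pose H u v := F (u ++ l :: v).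
(* [shuf_splits] detaches [u], and [shuf_prefix] treats what follows. The sign depends on [u] only
   through its parity, so [a1 ++ b1] replaces [u] there. *)
have -> : shuf a b insertion = splits a (fun a1 a2 => splits b (fun b1 b2 =>
    sg a2 b1 * (splits a2 (fun u v => sg (a1 ++ b1) (l :: u) * c u *
                   shuf a1 b1 (fun s => shuf v b2 (H s)))
              + splits b2 (fun u v => sg a2 u * (sg (a1 ++ b1) (l :: u) * c u *
                   shuf a1 b1 (fun s => shuf a2 v (H s))))))).
  rewrite shuf_splits; apply: eq_splits => a1 a2 a12; apply: eq_splits => b1 b2 b12.
  congr (_ * _).
  have -> : shuf a1 b1 (fun u => shuf a2 b2 (fun s =>
      splits s (fun v v' => sg u (l :: v) * c v * F (u ++ l :: v'))))
    = shuf a1 b1 (fun s =>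
        splits a2 (fun u v => sg (a1 ++ b1) (l :: u) * c u * shuf v b2 (H s))
        + splits b2 (fun u v => sg a2 u * (sg (a1 ++ b1) (l :: u) * c u
                                           * shuf a2 v (H s)))).
    apply: eq_shuf => w /wpar_perm pw.
    rewrite -(@shuf_prefix hom (fun v => sg (a1 ++ b1) (l :: v) * c v)) ?c0 ?mulr0 //.
    - by apply: eq_shuf => s _; apply: eq_splits => v v' _; rewrite /sg pw.
    - move=> a' b' a'0 b'0 hom_ab'.
      under eq_shuf => v _ do rewrite /sg wpar_cons.
      rewrite (shuf_par (fun p => (-1) ^+ (wpar (a1 ++ b1) && (par l (+) p)))).
      by rewrite shuf_c ?mulr0.
    move: hom_ab; rewrite -a12 -b12 !all_cat.
    by case/andP=> /andP[_ ->] /andP[_ ->].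
  rewrite shufD -!splits_shuf.
  by congr (_ + _); apply: eq_splits => u v _; rewrite !shufZ.
rewrite (@eq_splits _ _ (fun a1 a2 => splits a2 (fun u v => splits b (fun b1 b2 =>
     sg a2 b1 * (sg (a1 ++ b1) (l :: u) * c u * shuf a1 b1 (fun s => shuf v b2 (H s)))))
   + splits b (fun b1 b2 => splits b2 (fun u v =>
     sg a2 b1 * (sg a2 u * (sg (a1 ++ b1) (l :: u) * c u *
                   shuf a1 b1 (fun s => shuf a2 v (H s)))))))); last first.
  move=> a1 a2 a12; rewrite [X in _ = X + _]splits_exchange -splitsD.
  by apply: eq_splits => b1 b2 _; rewrite mulrDr -!splitsZ.
rewrite splitsD [X in _ + X]splits_exchange.
(* First sum: [a] is cut as [a1 ++ u ++ v] with [u] given to [c], and [shuf_insert] makes the sum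
   over the cuts of [b] a shuffle of [a1 ++ l :: v] with [b]. *)
rewrite [X in X + _](@eq_splits _ _ (fun _ _ => 0)) ?splits0 ?add0r; last first.
  move=> a1 a2 a12; rewrite (@eq_splits _ _ (fun _ _ => 0)) ?splits0 // => u v uv.
  have <- : sg a1 (l :: u) * c u * shuf (a1 ++ l :: v) b F = 0.
    rewrite shuf_F ?mulr0 //; first by case: (a1).
    move: hom_ab; rewrite -a12 -uv !all_cat /= hom_l.
    by case/andP=> /and3P[-> _ ->] ->.
  rewrite shuf_insert -splitsZ; apply: eq_splits => b1 b2 b12.
  rewrite -/(H _) !mulrA; congr (_ * _).
  rewrite -uv !sg_catl !(sg_consr l u) (sg_consr l v) (sgC u b1) (sgC v b1).
  rewrite -[RHS]mul1r -(sg_sq b1 u); ring.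
(* Second sum: the argument of [c] comes from [b]. As [shuf_insert] acts on the left factor, graded
   commutativity is applied before and after it. *)
rewrite (@eq_splits _ _ (fun _ _ => 0)) ?splits0 // => b1 b2 b12.
rewrite splits_exchange (@eq_splits _ _ (fun _ _ => 0)) ?splits0 // => u v uv.
have <- : sg b1 (l :: u) * c u * sg a (l :: u) * shuf a (b1 ++ l :: v) F = 0.
  rewrite shuf_F ?mulr0 //; first by case: (b1).
  move: hom_ab; rewrite -b12 -uv !all_cat /= hom_l.
  by case/and4P=> -> -> _ ->.
rewrite shufC shuf_insert -!splitsZ; apply: eq_splits => a1 a2 a12.
rewrite shufC; under [in RHS]eq_shuf => w pw do rewrite shufC.
rewrite shufZ !mulrA; congr (_ * _).
rewrite -a12 !(sg_catl, sg_catr) !(sg_consr l u) !(sg_consr l v) (sgC v).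
(* The squares of signs are set apart for [sg_sq], since [ring] does not know that they equal 1. *)
transitivity (sg a2 b1 * sg a2 u * sg a1 [:: l] * sg a1 u * sg b1 [:: l] * sg b1 u
  * c u * sg a1 b1 * (sg a2 [:: l] * sg a2 [:: l]) * (sg a1 v * sg a1 v)
  * (sg a2 v * sg a2 v) * (sg a1 [:: l] * sg a1 [:: l])).
  by rewrite !sg_sq; ring.
ring.
Qed.

End Insertion.

(** The value of [c] at the empty word is split off: it contributes the insertion of [l] alone, that
    is, [F] on the shuffle of [[:: l]] with [w]. *)
Lemma shuf_insertion (hom : pred T) l (c F : seq T -> K) a b :
  hom l ->
  (forall a b, a != [::] -> b != [::] -> all hom (a ++ b) -> shuf a b c = 0) ->
  (forall a b, a != [::] -> b != [::] -> all hom (a ++ b) -> shuf a b F = 0) ->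
  a != [::] -> b != [::] -> all hom (a ++ b) -> shuf a b (insertion l c F) = 0.
Proof.
move=> hom_l shuf_c shuf_F a0 b0 hom_ab.
pose c' v := if v is [::] then 0 else c v.
have -> : shuf a b (insertion l c F)
  = shuf a b (insertion l c' F) + c [::] * shuf a b (fun w => shuf [:: l] w F).
  rewrite -shufZ -shufD; apply: eq_shuf => w _.
  rewrite (shuf_insert [::]) -splitsZ -splitsD; apply: eq_splits => u s _.
  case: s => [|x s]; first by rewrite /= !shuf0w; ring.
  rewrite !splits_cons /= mulr0 mul0r add0r addrC; congr (_ + _).
  by rewrite !shuf0w; ring.
rewrite (shuf_insertion_pos hom_l) //; last first.
  move=> a' b' a'0 b'0 hom_ab'; rewrite -(shuf_c _ _ a'0 b'0 hom_ab').
  apply: eq_shuf => w /perm_size; case: w => //.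
  by case: a' {hom_ab'} a'0.
(* Each [w] rearranges [a ++ b], hence is non-empty, and [F] kills its shuffle with [[:: l]]. *)
rewrite add0r (@eq_shuf _ _ _ (fun=> 0)) ?shuf0 ?mulr0 // => w pw.
rewrite shuf_F //=; last by rewrite hom_l (perm_all _ pw).
by move/perm_size: pw; case: w => //; case: (a) a0.
Qed.

End SignedWords.

(** * Permutations as words *)

Section OneLine.

Local Open Scope nat_scope.

Section FixedSize.

Variable n : nat.

Implicit Types sigma tau : 'S_n.

(** The word of the inverse, with positions counted from 0: it lists the letters in the order in
    which [permute] puts them. *)
Definition one_line sigma : seq nat := [seq val ((sigma^-1)%g i) | i : 'I_n].

Lemma size_one_line sigma : size (one_line sigma) = n.
Proof. by rewrite size_map size_enum_ord. Qed.

Lemma nth_one_line sigma (i : 'I_n) : nth 0 (one_line sigma) i = (sigma^-1)%g i.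
Proof. by rewrite (nth_map i) ?size_enum_ord // nth_ord_enum. Qed.

Lemma eq_one_line sigma (s : seq nat) :
  size s = n -> (forall i : 'I_n, nth 0 s i = (sigma^-1)%g i) -> one_line sigma = s.
Proof.
move=> sz_s nth_s; apply: (@eq_from_nth _ 0); rewrite size_one_line ?sz_s //.
by move=> i lt_i_n; rewrite (nth_one_line sigma (Ordinal lt_i_n)) -nth_s.
Qed.

Lemma one_line_inj : injective one_line.
Proof.
move=> sigma tau eq_st; apply: invg_inj; apply/permP => i.
by apply: val_inj; rewrite /= -!nth_one_line eq_st.
Qed.

Lemma perm_one_line sigma : perm_eq (one_line sigma) (iota 0 n).
Proof.
apply: uniq_perm; rewrite ?iota_uniq //.
  by rewrite map_inj_uniq ?enum_uniq // => i j /val_inj /perm_inj.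
move=> k; rewrite mem_iota /= add0n; apply/mapP/idP => [[i _ ->] | lt_k_n].
  exact: ltn_ord.
by exists (sigma (Ordinal lt_k_n)); rewrite ?mem_enum // permK.
Qed.

Lemma one_line_surj (s : seq nat) :
  perm_eq s (iota 0 n) -> exists sigma, one_line sigma = s.
Proof.
move=> perm_s; have sz_s : size s = n by rewrite (perm_size perm_s) size_iota.
have lt_s (i : 'I_n) : (nth 0 s i < n)%N.
  have: nth 0 s i \in iota 0 n by rewrite -(perm_mem perm_s) mem_nth ?sz_s.
  by rewrite mem_iota.
have s_inj : injective (fun i => Ordinal (lt_s i)).
  move=> i j /(congr1 val) /= /eqP; rewrite nth_uniq ?sz_s //.
    by move/eqP/val_inj.
  by rewrite (perm_uniq perm_s) iota_uniq.
exists (perm s_inj)^-1%g; apply: eq_one_line => // i.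
by rewrite invgK permE.
Qed.

End FixedSize.

(** Same nested recursion as [shuf], on positions and without signs. *)
Fixpoint interleavings (a : seq nat) : seq nat -> seq (seq nat) :=
  if a is x :: a' then
    fix interleavings_a b :=
      if b is y :: b' then
        map (cons x) (interleavings a' b) ++ map (cons y) (interleavings_a b')
      else [:: a]
  else fun b => [:: b].

Lemma interleavings_cons x a y b :
  interleavings (x :: a) (y :: b)
  = map (cons x) (interleavings a (y :: b)) ++ map (cons y) (interleavings (x :: a) b).
Proof. by []. Qed.

#[global] Arguments interleavings : simpl never.

Lemma mem_map_cons (T : eqType) (x z : T) s (ss : seq (seq T)) :
  (z :: s \in map (cons x) ss) = (z == x) && (s \in ss).
Proof.
apply/mapP/andP => [[s' s'_ss [-> ->]] // | [/eqP-> s_ss]]; by exists s.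
Qed.

(** The threshold [p] tells the letters of [a] from those of [b], so both subwords are recovered by
    filtering. *)
Lemma mem_interleavings p a b s : all (fun k => k < p)%N a -> all (leq p) b ->
  (s \in interleavings a b)
  = (filter (fun k => k < p)%N s == a) && (filter (leq p) s == b).
Proof.
elim: s a b => [|z s IHs] [|x a] [|y b] //.
- by rewrite interleavings_cons mem_cat => _ _; apply/orP => -[] /mapP[].
- by move=> _ _; rewrite inE /=; case: ltnP => _; rewrite ?andbF.
- move=> _ lt_b; rewrite inE.
  have := IHs [::] b isT; rewrite inE => {}IHs.
  case/andP: lt_b => lt_y lt_b; rewrite eqseq_cons IHs //=.
  case: (ltnP z p) => lt_zp /=; last by rewrite eqseq_cons andbCA.
  by have /negbTE-> : z != y by apply: contraTneq lt_y => <-; rewrite -ltnNge.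
- move=> lt_a _; rewrite inE.
  have := IHs a [::]; rewrite -[_ \in _]/(s \in interleavings a [::]).
  have -> : interleavings a [::] = [:: a] by case: (a).
  rewrite inE => {}IHs.
  case/andP: lt_a => /= lt_x lt_a; rewrite eqseq_cons IHs //=.
  case: (ltnP z p) => lt_zp /=; first by rewrite eqseq_cons andbA.
  have /negbTE-> : z != x by apply: contraTneq lt_x => <-; rewrite -leqNgt.
  by rewrite andbF.
move=> lt_a lt_b; rewrite interleavings_cons mem_cat !mem_map_cons !IHs //=; last first.
- by case/andP: lt_a.
- by case/andP: lt_b.
case/andP: lt_a => /= lt_x _; case/andP: lt_b => lt_y _.
case: (ltnP z p) => lt_zp /=; rewrite !eqseq_cons.
  have /negbTE-> /= : z != y by apply: contraTneq lt_y => <-; rewrite -ltnNge.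
  by rewrite orbF andbA.
have /negbTE-> /= : z != x by apply: contraTneq lt_x => <-; rewrite -leqNgt.
by rewrite andbCA.
Qed.

Lemma interleavings_uniq p a b : all (fun k => k < p)%N a -> all (leq p) b ->
  uniq (interleavings a b).
Proof.
elim: a b => [|x a IHa] b //.
elim: b => [|y b IHb] // lt_a lt_b.
rewrite interleavings_cons cat_uniq !map_inj_uniq; try by move=> ? ? [].
case/andP: (lt_a) => /= lt_x lt_a'; case/andP: (lt_b) => lt_y lt_b'.
rewrite IHa // IHb // andbT /=; apply/hasPn => _ /mapP[s _ ->].
rewrite mem_map_cons negb_and (_ : y != x) //.
by apply: contraTneq lt_x => <-; rewrite -leqNgt.
Qed.

Lemma perm_interleavings a b s : s \in interleavings a b -> perm_eq s (a ++ b).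
Proof.
elim: a b s => [|x a IHa] b s; first by rewrite inE => /eqP->.
elim: b s => [|y b IHb] s; first by rewrite inE cats0 => /eqP->.
rewrite interleavings_cons mem_cat => /orP[] /mapP[s' s'_ab ->].
  by rewrite cat_cons perm_cons IHa.
by rewrite -[y :: b]cat1s perm_sym perm_catCA cat1s perm_cons perm_sym IHb.
Qed.

Lemma pairwise_filter_imply (T : Type) (r : rel T) (P : pred T) s :
  pairwise r (filter P s) = pairwise (fun x y => P x && P y ==> r x y) s.
Proof.
elim: s => //= x s <-; case Px: (P x) => /=; rewrite ?andTb.
  by rewrite all_filter; congr (_ && _); apply: eq_all => y /=.
by rewrite all_predT.
Qed.

Lemma pairwise_enum_ord n (r : rel 'I_n) :
  pairwise r (enum 'I_n) = [forall i : 'I_n, forall j : 'I_n, (i < j)%N ==> r i j].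
Proof.
case: n r => [|n] r.
  by rewrite (size0nil (size_enum_ord 0)); apply/esym/forallP => -[].
apply/(pairwiseP ord0)/forallP => [pw_r i | pw_r i j].
  apply/forallP => j; apply/implyP => lt_ij.
  by have := pw_r i j; rewrite !inE size_enum_ord !nth_ord_enum; apply.
rewrite !inE size_enum_ord => lt_i lt_j lt_ij.
rewrite -[i]/(val (Ordinal lt_i)) -[j]/(val (Ordinal lt_j)) !nth_ord_enum.
by have /forallP/(_ (Ordinal lt_j))/implyP := pw_r (Ordinal lt_i); apply.
Qed.

Lemma pairwise_one_line n (r : rel nat) (sigma : 'S_n) :
  pairwise r (one_line sigma)
  = [forall i : 'I_n, forall j : 'I_n,
       (i < j)%N ==> r ((sigma^-1)%g i) ((sigma^-1)%g j)].
Proof. by rewrite pairwise_map pairwise_enum_ord. Qed.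

(** A permutation is increasing on each block exactly when the entries of each block occur in
    increasing order in the word of its inverse. *)
Lemma shufflesE p n (sigma : 'S_n) : (p <= n)%N ->
  (sigma \in shuffles p n)
  = (one_line sigma \in interleavings (iota 0 p) (iota p (n - p))).
Proof.
move=> le_pn.
have sorted_eq (P : pred nat) m k : 
    filter P (iota 0 n) = iota m k ->
    (filter P (one_line sigma) == iota m k) = sorted ltn (filter P (one_line sigma)).
  move=> eqP_; apply/eqP/idP => [-> | sorted_s]; first exact: iota_ltn_sorted.
  apply: (irr_sorted_eq ltn_trans ltnn) => //; first exact: iota_ltn_sorted.
  by apply: perm_mem; rewrite -eqP_ perm_filter // perm_one_line.
have iota_n : iota 0 n = iota 0 p ++ iota p (n - p).
  by rewrite -[X in iota 0 X = _](subnKC le_pn) iotaD.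
have all_lt : all (fun k => k < p)%N (iota 0 p).
  by apply/allP => k; rewrite mem_iota.
have all_ge : all (leq p) (iota p (n - p)).
  by apply/allP => k; rewrite mem_iota => /andP[].
have filter_lt : filter (fun k => k < p)%N (iota 0 n) = iota 0 p.
  rewrite iota_n filter_cat (all_filterP all_lt) -[RHS]cats0; congr (_ ++ _).
  rewrite -(filter_pred0 (iota p (n - p))); apply: eq_in_filter => k /(allP all_ge).
  by rewrite ltnNge => ->.
have filter_ge : filter (leq p) (iota 0 n) = iota p (n - p).
  rewrite iota_n filter_cat (all_filterP all_ge) -[RHS]cat0s; congr (_ ++ _).
  rewrite -(filter_pred0 (iota 0 p)); apply: eq_in_filter => k /(allP all_lt) lt_k.
  by apply/negbTE; rewrite -ltnNge.
rewrite (@mem_interleavings p) //.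
rewrite !sorted_eq // !sorted_pairwise; try exact: ltn_trans.
rewrite !pairwise_filter_imply !pairwise_one_line inE.
apply/forallP/andP => [inc | [/forallP inc1 /forallP inc2] i].
  (* An inversion of the inverse permutation within a block would, through [inc], reverse the order
     of [i] and [j]. *)
  have inc' (i j : 'I_n) : (i < j)%N ->
      ((sigma^-1)%g i < p)%N && ((sigma^-1)%g j < p)%N
      || (p <= (sigma^-1)%g i)%N && (p <= (sigma^-1)%g j)%N ->
      ((sigma^-1)%g i < (sigma^-1)%g j)%N.
    move=> lt_ij Pij; rewrite ltnNge leq_eqVlt.
    apply/negP => /orP[/eqP/val_inj/perm_inj eq_ij | lt_ji].
      by move: lt_ij; rewrite eq_ij ltnn.
    have /forallP/(_ ((sigma^-1)%g i))/implyP := inc ((sigma^-1)%g j).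
    rewrite !permKV lt_ji [(j < i)%N]ltnNge (ltnW lt_ij) /=.
    by case/orP: Pij => [/andP[-> _] | /andP[_ ->]]; rewrite ?orbT => /(_ isT).
  by split; apply/forallP => i; apply/forallP => j; apply/implyP => lt_ij;
    apply/implyP => Pij; apply: inc'; rewrite // Pij ?orbT.
apply/forallP => j; apply/implyP => /andP[lt_ij lt_p].
rewrite ltnNge leq_eqVlt; apply/negP => /orP[/eqP/val_inj/perm_inj eq_ij|lt_s].
  by move: lt_ij; rewrite eq_ij ltnn.
case/orP: lt_p => [lt_jp | le_pi].
  have /forallP/(_ (sigma i))/implyP/(_ lt_s) := inc1 (sigma j).
  by rewrite /= !permK lt_jp (ltn_trans lt_ij) //= ltnNge ltnW.
have /forallP/(_ (sigma i))/implyP/(_ lt_s) := inc2 (sigma j).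
by rewrite /= !permK le_pi (leq_trans le_pi (ltnW lt_ij)) /= ltnNge ltnW.
Qed.

Lemma perm_shuffles p n : (p <= n)%N ->
  perm_eq [seq one_line sigma | sigma in shuffles p n]
          (interleavings (iota 0 p) (iota p (n - p))).
Proof.
move=> le_pn; apply: uniq_perm.
- by rewrite map_inj_uniq ?enum_uniq //; apply: one_line_inj.
- apply: (@interleavings_uniq p); apply/allP => k.
    by rewrite mem_iota add0n.
  by rewrite mem_iota => /andP[].
move=> s; apply/mapP/idP => [[sigma] | s_ab].
  by rewrite mem_enum shufflesE // => ? ->.
have /one_line_surj[sigma def_s] : perm_eq s (iota 0 n).
  by rewrite (perm_trans (perm_interleavings s_ab)) // -iotaD subnKC.
by exists sigma; rewrite // mem_enum shufflesE // def_s.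
Qed.

(** Inverse powers of the cycle give the rotations, because [one_line] reads the inverse. For
    [n = 0] the right-hand list would miss the identity. *)
Lemma perm_rotations n : (0 < n)%N ->
  perm_eq [seq one_line tau | tau in <[ncycle n]>%g]
          [seq rot k (iota 0 n) | k <- iota 0 n].
Proof.
move=> n_gt0.
have ncycleX k (i : 'I_n) : (ncycle n ^+ k)%g i = (i + k) %% n :> nat.
  elim: k => [|k IHk]; first by rewrite expg0 perm1 addn0 modn_small.
  by rewrite expgSr permM permE /= IHk -addn1 modnDml -addnA addn1.
have one_lineX k : one_line (ncycle n ^- k) = rot (k %% n) (iota 0 n).
  apply: eq_one_line => [|i]; first by rewrite size_rot size_iota.
  rewrite invgK ncycleX -modnDmr /rot nth_cat size_drop size_iota drop_iota take_iota.
  have := ltn_pmod k n_gt0; move: (k %% n) => m lt_m.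
  have lt_i := ltn_ord i.
  case: ltnP => [lt_i_nm | le_nm_i].
    by rewrite nth_iota // modn_small; lia.
  rewrite (minn_idPl (ltnW lt_m)) nth_iota; last by lia.
  have -> : (i + m = n + (i + m - n))%N by lia.
  by rewrite modnDl modn_small; lia.
apply: uniq_perm.
- by rewrite map_inj_uniq ?enum_uniq //; apply: one_line_inj.
- rewrite map_inj_in_uniq ?iota_uniq // => k k'.
  rewrite !mem_iota !add0n /= => lt_k lt_k'.
  move/(congr1 (head 0%N)).
  by rewrite -!nth0 !nth_cat !size_drop !size_iota !subn_gt0 lt_k lt_k' !nth_drop
     !nth_iota ?addn0.
move=> s; apply/mapP/mapP => [[tau] | [k]].
  rewrite mem_enum -groupV => /cycleP[k def_tau] ->.
  exists (k %% n); rewrite ?mem_iota ?add0n ?ltn_pmod //.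
  by rewrite -one_lineX -def_tau invgK.
rewrite mem_iota add0n /= => lt_k ->.
exists ((ncycle n ^- k)%g); first by rewrite mem_enum groupV mem_cycle.
by rewrite one_lineX modn_small.
Qed.

End OneLine.

(** * Koszul signs read off words of positions *)

Section InversionSign.

Variables (K : fieldType) (T : eqType) (par : pred T) (x : nat -> T).

Implicit Types (s a b : seq nat).

Notation sg := (sg K par).

(** Each entry is charged for the smaller ones to its right. *)
Fixpoint inversion_sign s : K :=
  if s is k :: s' then
    \prod_(m <- s' | (m < k)%N) (-1) ^+ (par (x k) && par (x m)) * inversion_sign s'
  else 1.

Lemma inversion_sign_map n (f : 'I_n -> nat) :
  inversion_sign [seq f i | i : 'I_n]
  = \prod_(i < n) \prod_(j < n | (i < j)%N && (f j < f i)%N)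
      (-1) ^+ (par (x (f i)) && par (x (f j))).
Proof.
elim: n f => [|n IHn] f; first by
  rewrite big_ord0 [image_mem _ _]size0nil // size_map size_enum_ord.
rewrite /image_mem enum_ordSl /= -map_comp IHn big_ord_recl; congr (_ * _).
  rewrite big_map big_enum_cond [RHS]big_mkcond big_ord_recl /= mul1r -big_mkcond.
  by apply: eq_bigl => i.
apply: eq_bigr => i _; rewrite [RHS]big_mkcond big_ord_recl /= mul1r -big_mkcond.
by apply: eq_bigl => j; rewrite /= /bump !leq0n !add1n ltnS.
Qed.

Lemma prod_sg y s :
  \prod_(m <- s) (-1) ^+ (par y && par (x m)) = sg [:: y] (map x s).
Proof.
elim: s => [|m s IHs]; first by rewrite big_nil sgw0.
by rewrite big_cons IHs [RHS]sg_consr /sg !wpar_cons wpar_nil !addbF.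
Qed.

(** The inversions are precisely the pairs with one entry in [a] and one in [b]. *)
Lemma inversion_sign_cat a b : pairwise ltn a -> pairwise ltn b -> allrel ltn b a ->
  inversion_sign (a ++ b) = sg (map x a) (map x b).
Proof.
elim: a => [_ | k a IHa /= /andP[lt_ka lt_a] lt_b].
  elim: b => [|m b IHb] /=; first by rewrite sg0w.
  case/andP=> lt_m /IHb {}IHb _.
  rewrite IHb // ?allrel0r // sg0w mulr1 big1_seq // => k /andP[lt_km /(allP lt_m)].
  by rewrite /= ltnNge ltnW.
rewrite allrel_consr => /andP[lt_bk lt_ba].
rewrite /= IHa // big_cat /= big1_seq ?mul1r; last first.
  by move=> m /andP[lt_mk /(allP lt_ka)] /=; rewrite ltnNge ltnW.
rewrite [RHS]sg_consl -prod_sg big_seq_cond [X in _ = X * _]big_seq_cond; congr (_ * _).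
apply: eq_bigl => m; rewrite andbT; case m_b: (m \in b) => //=.
exact: (allP lt_bk).
Qed.

Lemma inversion_sign_sorted s : pairwise ltn s -> inversion_sign s = 1.
Proof. by move=> lt_s; rewrite (@inversion_sign_cat [::]) // allrel0r. Qed.

(** When [a ++ b] is increasing, the inversions of an interleaving are the pairs in which an entry
    of [b] precedes one of [a]: those charged by [shuf]. *)
Lemma sum_interleavings a b (F : seq T -> K) : pairwise ltn (a ++ b) ->
  \sum_(s <- interleavings a b) inversion_sign s * F (map x s)
  = shuf par (map x a) (map x b) F.
Proof.
elim: a b F => [|k a IHa] b F.
  by move=> lt_b; rewrite big_seq1 inversion_sign_sorted // mul1r.
elim: b F => [|m b IHb] F lt_ab.
  by rewrite big_seq1 inversion_sign_sorted ?mul1r // -[k :: a]cats0.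
rewrite interleavings_cons big_cat !big_map /= shuf_cons.
have lt_kab : pairwise ltn ((k :: a) ++ b).
  by apply: subseq_pairwise lt_ab; rewrite cat_subseq // subseq_cons.
move: (lt_ab); rewrite pairwise_cat => /and3P[lt_ka_mb _ /andP[lt_mb _]].
move: lt_ka_mb; rewrite allrel_consr => /andP[lt_kam _].
case/andP: lt_ab => lt_k lt_ab; congr (_ + _).
  rewrite -(IHa (m :: b)) //; apply: eq_big_seq => s s_ab /=.
  rewrite big1_seq ?mul1r // => m' /andP[lt_m'].
  rewrite (perm_mem (perm_interleavings s_ab)) => /(allP lt_k) /=.
  by rewrite ltnNge ltnW.
rewrite -(IHb _ lt_kab) big_distrr; apply: eq_big_seq => s s_ab /=.
rewrite (perm_big _ (perm_interleavings s_ab)) big_cat /= [X in _ * X * _ * _]big1_seq.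
  rewrite mulr1 -(prod_sg (x m) (k :: a)) !mulrA; congr (_ * _ * _).
  rewrite big_seq_cond [RHS]big_seq_cond; apply: eq_bigl => k'.
  by rewrite andbT; case k'_a: (k' \in k :: a) => //=; apply: (allP lt_kam).
by move=> m' /andP[lt_m' /(allP lt_mb)] /=; rewrite ltnNge ltnW.
Qed.

End InversionSign.

(** * The Koszul action and cyclicity in terms of words *)

Section KoszulAction.

Variables (K : fieldType) (V : vectType K).

Implicit Types (w u v a b : seq (letter V)) (Omega : mform V).

Definition odd_letter (l : letter V) : bool := odd `|sdeg l|%N.

Notation sg := (sg K odd_letter).

Lemma koszul_actE Omega w (sigma : 'S_(size w)) :
  koszul_act Omega sigma
  = inversion_sign K odd_letter (nth (0, 0) w) (one_line sigma)
    * Omega (unzip2 (map (nth (0, 0) w) (one_line sigma))).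
Proof.
rewrite /koszul_act; congr (_ * _).
  (* [ksign] runs over the original places and [inversion_sign_map] over the final ones; both
     indices are substituted, then exchanged. *)
  rewrite /ksign inversion_sign_map (reindex_inj (@perm_inj _ (sigma^-1)%g)) /=.
  under eq_bigr => i _ do
    rewrite (reindex_inj (@perm_inj _ (sigma^-1)%g)) /= big_mkcond /=.
  rewrite exchange_big /=; apply: eq_bigr => j _; rewrite [RHS]big_mkcond /=.
  apply: eq_bigr => i _; rewrite !permKV andbC; case: ifP => // _.
  by rewrite /sgn2 !(tnth_nth (0, 0)) andbC.
rewrite /permute -map_comp; congr (Omega (map _ _)).
by apply: eq_map => i; rewrite (tnth_nth (0, 0)).
Qed.

Lemma sum_shuffles Omega a b :
  \sum_(sigma in shuffles (size a) (size (a ++ b))) koszul_act Omega sigma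
  = shuf odd_letter a b (fun w => Omega (unzip2 w)).
Proof.
under eq_bigr do rewrite koszul_actE.
set x := nth (0, 0) (a ++ b).
transitivity (\sum_(s <- [seq one_line sigma |
                            sigma in shuffles (size a) (size (a ++ b))])
    inversion_sign K odd_letter x s * Omega (unzip2 (map x s))).
  by rewrite big_image.
rewrite (perm_big _ (perm_shuffles _)) /=; last by rewrite size_cat leq_addr.
rewrite (sum_interleavings odd_letter x (fun w => Omega (unzip2 w))); last first.
  rewrite -iotaD -sorted_pairwise ?iota_ltn_sorted //; exact: ltn_trans.
rewrite size_cat addKn; congr (shuf _ _ _ _).
  by rewrite map_nth_iota0 ?take_size_cat // size_cat leq_addr.
by rewrite map_nth_iota ?drop_size_cat ?take_size // size_cat addKn.
Qed.

(** The [(size w).+1] rotations of [rcons w y] match the cuts of [w]: the part [u] before the cut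
    goes behind [y]. *)
Lemma cycl_rcons Omega w y :
  cycl Omega (rcons w y)
  = splits w (fun u v => sg u (rcons v y) * Omega (unzip2 (rcons v y ++ u))).
Proof.
rewrite /cycl; under eq_bigr do rewrite koszul_actE.
set x := nth (0, 0) (rcons w y).
transitivity (\sum_(s <- [seq one_line tau | tau in <[ncycle (size (rcons w y))]>%g])
    inversion_sign K odd_letter x s * Omega (unzip2 (map x s))).
  by rewrite big_image.
rewrite (perm_big _ (perm_rotations _)) ?size_rcons // big_map splits_nseq.
have map_x : map x (iota 0 (size w).+1) = rcons w y.
  by rewrite -(size_rcons w y) -/(mkseq x _) mkseq_nth.
rewrite -(big_mkord xpredT (fun k => sg (take k w) (rcons (drop k w) y)
            * Omega (unzip2 (rcons (drop k w) y ++ take k w)))) /index_iota subn0.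
apply: eq_big_seq => k; rewrite mem_iota add0n ltnS => /andP[_ lt_k].
rewrite /rot inversion_sign_cat; last 3 first.
- rewrite -sorted_pairwise; last exact: ltn_trans.
  by rewrite drop_iota iota_ltn_sorted.
- rewrite -sorted_pairwise; last exact: ltn_trans.
  by rewrite take_iota iota_ltn_sorted.
- apply/allrelP => i j; rewrite take_iota drop_iota !mem_iota; lia.
rewrite map_cat map_take map_drop map_x sgC drop_rcons //.
by rewrite -cats1 takel_cat.
Qed.

Lemma one_line_ncycle n : one_line (ncycle n.+1) = n :: iota 0 n.
Proof.
apply: eq_one_line => [|i]; first by rewrite /= size_iota.
rewrite -{1}(permKV (ncycle n.+1) i); move: ((ncycle n.+1)^-1%g i) => j.
rewrite permE /=; have := ltn_ord j; rewrite ltnS leq_eqVlt => /orP[/eqP-> | lt_j].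
  by rewrite modnn.
by rewrite modn_small //= nth_iota.
Qed.

Variable gr : int -> {vspace V}.

Lemma cyclic_rcons Omega u y : is_cyclic gr Omega -> homogeneous gr (rcons u y) ->
  Omega (unzip2 (rcons u y)) = sg [:: y] u * Omega (unzip2 (y :: u)).
Proof.
move=> cycO hom_uy; rewrite -(cycO _ hom_uy) koszul_actE.
have -> : one_line (ncycle (size (rcons u y))) = size u :: iota 0 (size u).
  by rewrite size_rcons one_line_ncycle.
rewrite -[_ :: _]cat1s inversion_sign_cat //; last 2 first.
- by rewrite -sorted_pairwise ?iota_ltn_sorted //; apply: ltn_trans.
- by apply/allrelP => i j; rewrite mem_iota inE => lt_i /eqP->.
have map_u : map (nth (0, 0) (rcons u y)) (iota 0 (size u)) = u.
  by rewrite map_nth_iota0 ?size_rcons // -cats1 take_size_cat.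
by rewrite map_cat map_u /= nth_rcons ltnn eqxx.
Qed.

(** The letters of [v] are brought to the front one at a time, from the right. *)
Lemma cyclic_cat Omega u v : is_cyclic gr Omega -> homogeneous gr (u ++ v) ->
  Omega (unzip2 (u ++ v)) = sg u v * Omega (unzip2 (v ++ u)).
Proof.
move=> cycO; elim/last_ind: v u => [|v y IHv] u hom_uv.
  by rewrite cats0 sgw0 mul1r.
rewrite -rcons_cat (cyclic_rcons cycO) ?rcons_cat // -cat_cons IHv; last first.
  by move: hom_uv; rewrite /homogeneous -rcons_cat all_rcons.
rewrite cat_rcons mulrA; congr (_ * _).
(* [y] crosses [v] twice, once in each move, so a square of signs cancels. *)
rewrite -cats1 !sg_catr (sg_consl _ _ y u) -[RHS]mulr1 -(sg_sq K odd_letter [:: y] v).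
by rewrite (sgC _ _ u [:: y]); ring.
Qed.

Lemma shuf_vsp Omega y a b : vanishes_on_shuffles gr Omega ->
  a != [::] -> b != [::] -> homogeneous gr (a ++ b) ->
  shuf odd_letter a b (fun w => Omega (rcons (unzip2 w) y)) = 0.
Proof.
move=> vO a0 b0 hom_ab.
rewrite -(sum_shuffles (insert_last y Omega)) vO // size_cat -{2}[size a]addn0 ltn_add2l.
by rewrite !lt0n !size_eq0 a0.
Qed.

End KoszulAction.

(** * Gradings and the Casimir element *)

Lemma scalar_pack (K : fieldType) (V : vectType K) (f : V -> K) : scalar f ->
  exists g : {scalar V}, g =1 f.
Proof.
move=> lin_f; pose g : {scalar V} := HB.pack f (GRing.isLinear.Build K V K *%R f lin_f).
by exists g.
Qed.

Section Grading.

Variables (K : fieldType) (V : vectType K) (gr : int -> {vspace V}).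

Lemma directv_seq (s : seq int) :
  directv (\sum_(i <- s) gr i) -> directv (\sum_(k < size s) gr s`_k).
Proof.
move=> dx_gr.
have {dx_gr} : (\dim (\sum_(i <- s) gr i) == \sum_(i <- s) \dim (gr i))%N := dx_gr.
by rewrite (big_nth 0) big_mkord [X in _ == X](big_nth 0) big_mkord.
Qed.

Lemma grading_proj : is_grading gr -> exists s (proj : int -> 'End(V)),
  [/\ uniq s, forall d x, proj d x \in gr d,
      forall x, x = \sum_(d <- s) proj d x
    & forall d d' x, x \in gr d' -> d != d' -> proj d x = 0].
Proof.
case=> s [uniq_s gr0 /directv_seq/directv_sum_independent dx_gr defV].
pose proj := sumv_pi_for (esym defV).
have proj_gr d x : proj d x \in gr d by apply: memv_sum_pi.
have proj_sum x : \sum_(d <- s) proj d x = x.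
  by rewrite sumv_pi_uniq_sum ?filter_predT ?memvf.
exists s, proj; split=> // d d' x x_gr ne_dd'.
have [d_s | /gr0 gr_d] := boolP (d \in s); last first.
  by apply/eqP; rewrite -memv0 -gr_d.
have [d'_s | /gr0 gr_d'] := boolP (d' \in s); last first.
  by move: x_gr; rewrite gr_d' memv0 => /eqP->; rewrite linear0.
(* The decomposition of [x] by the projections minus the one with [x] alone in degree [d']: the sum
   is zero, so independence kills each term. *)
pose us i := proj i x - (if i == d' then x else 0).
have us0 : \sum_(k < size s) us s`_k = 0.
  have : \sum_(i <- s) us i = 0.
    rewrite sumrB proj_sum (bigD1_seq d') //= eqxx big1 ?addr0 ?subrr //.
    by move=> i /negPf->.
  by rewrite (big_nth 0) big_mkord.
have lt_d : (index d s < size s)%N by rewrite index_mem.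
have := dx_gr (fun k => us s`_k) _ us0 (Ordinal lt_d) isT.
rewrite /= nth_index // /us (negPf ne_dd') subr0; apply=> k _.
apply: rpredB => //; case: eqP => [-> // | _]; exact: mem0v.
Qed.

(** The element [sum_i e_i (x) e'_i] is tested on pairs of linear forms. Its components in degrees
    [d], [d'] with [d + d' != 0] vanish because [b] has degree 0. *)
Lemma homogeneous_casimir (b : {biscalar V}) (e e' : (\dim {:V}).-tuple V) :
  is_grading gr -> quadratic_form gr b -> basis_of {:V} e ->
  (forall i j, b (tnth e i) (tnth e' j) = (i == j)%:R) ->
  exists2 cas : seq (letter V * letter V),
    all (fun c => [&& c.1.2 \in gr c.1.1, c.2.2 \in gr c.2.1 & c.1.1 + c.2.1 == 0]) cas
    & forall f g : V -> K, scalar f -> scalar g ->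
      \sum_i f (tnth e i) * g (tnth e' i) = \sum_(c <- cas) f c.1.2 * g c.2.2.
Proof.
move=> /grading_proj[s [proj [uniq_s proj_gr proj_sum proj0]]] bP e_basis b_ee'.
have b_expand x : x = \sum_i b x (tnth e' i) *: tnth e i.
  have def_x := coord_basis e_basis (memvf x).
  rewrite {1}def_x; apply: eq_bigr => i _; rewrite -tnth_nth; congr (_ *: _).
  rewrite {2}def_x linear_sumlz (bigD1 i) //= big1 ?addr0.
    by rewrite -tnth_nth linearZl_LR b_ee' eqxx mulr1.
  by move=> j /negPf ne_ji; rewrite -tnth_nth linearZl_LR b_ee' ne_ji mulr0.
(* Non-degeneracy is given for the left argument; graded symmetry carries it to the right one when
   [v] is homogeneous. *)
have b_nondegr d v : v \in gr d -> (forall k x, x \in gr k -> b x v = 0) -> v = 0.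
  move=> v_gr bv0; apply: (qf_nondegenerate bP) => y.
  rewrite [y]proj_sum linear_sumr big1 // => k _.
  by rewrite (qf_symmetric bP v_gr (proj_gr k y)) (bv0 k) ?mulr0.
pose cas := [seq ((q.1, proj q.1 (tnth e i)), (q.2, proj q.2 (tnth e' i)))
  | q <- [seq q <- [seq (d, d') | d <- s, d' <- s] | q.1 + q.2 == 0],
    i <- enum 'I_(\dim {:V})].
exists cas.
  apply/allP => c /allpairsP[[q i] /= [q_s _ ->]] /=.
  by rewrite !proj_gr; move: q_s; rewrite mem_filter => /andP[].
move=> f0 g0 /scalar_pack[f def_f] /scalar_pack[g def_g].
under eq_bigr do rewrite -def_f -def_g.
under [RHS]eq_bigr do rewrite -def_f -def_g.
rewrite big_allpairs_dep /= big_filter [RHS]big_mkcond [RHS]big_allpairs.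
transitivity (\sum_(d <- s) \sum_(d' <- s) \sum_i
    f (proj d (tnth e i)) * g (proj d' (tnth e' i))).
  under [RHS]eq_bigr do rewrite exchange_big.
  rewrite [RHS]exchange_big; apply: eq_bigr => i _.
  rewrite {1}[tnth e i]proj_sum {1}[tnth e' i]proj_sum !linear_sum big_distrl /=.
  by apply: eq_bigr => d _; rewrite big_distrr.
apply: eq_bigr => d _; apply: eq_big_seq => d' d'_s.
case: ifPn => /= [_ | ne_dd']; first by rewrite big_enum.
(* [v0] represents [f] composed with [proj d] under [b], and the component at hand is
   [g (proj d' v0)]. *)
pose v0 := \sum_i f (proj d (tnth e i)) *: tnth e' i.
have b_v0 x : b x v0 = f (proj d x).
  transitivity (f (proj d (\sum_i b x (tnth e' i) *: tnth e i))).
    2: by rewrite -b_expand.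
  rewrite linear_sumr [in RHS]linear_sum [in RHS]linear_sum; apply: eq_bigr => i _.
  by rewrite linearZr_LR !linearZ mulrC.
suff pv0 : proj d' v0 = 0.
  transitivity (g (proj d' v0)); last by rewrite pv0 linear0.
  by rewrite /v0 !linear_sum; apply: eq_bigr => i _; rewrite !linearZ.
apply: (b_nondegr d') => // k x x_gr.
have [kd'0 | kd'n0] := eqVneq (k + d') 0; last first.
  exact: (qf_degree0 bP x_gr (proj_gr d' v0)).
(* Here [k = - d'] differs from [d], so [b x v0 = f (proj d x) = 0]; and [x] pairs only with the
   component of [v0] of degree [d']. *)
have ne_dk : d != k by apply: contraNneq ne_dd' => ->; rewrite kd'0.
rewrite -[RHS](linear0 f) -(proj0 d k x x_gr ne_dk) -b_v0 [in RHS](proj_sum v0).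
rewrite linear_sumr (bigD1_seq d') //= big1 ?addr0 // => j ne_jd'.
apply: (qf_degree0 bP x_gr (proj_gr j v0)).
by apply: contraNneq ne_jd' => kj0; rewrite -(inj_eq (addrI k)) kj0 kd'0.
Qed.

End Grading.

(** * The bracket *)

Section Bracket.

Variables (K : fieldType) (V : vectType K) (gr : int -> {vspace V}).

Implicit Types (w u v a b : seq (letter V)) (Omega : mform V).

Notation sg := (sg K (@odd_letter K V)).

Lemma multilinear_scalar Omega (s1 s2 : seq V) : multilinear Omega ->
  scalar (fun x => Omega (s1 ++ x :: s2)).
Proof. by move=> mO a x y; rewrite mO. Qed.

Lemma multilinear_last Omega (s : seq V) : multilinear Omega ->
  scalar (fun x => Omega (rcons s x)).
Proof. by move=> mO a x y; rewrite -!cats1 mO. Qed.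

Lemma tensor_letters Omega Omega' w :
  tensor Omega Omega' (unzip2 w)
  = splits w (fun u v => Omega (unzip2 u) * Omega' (unzip2 v)).
Proof.
rewrite splits_nseq /tensor size_map; apply: eq_bigr => k _.
by rewrite -map_take -map_drop.
Qed.

(** The contribution of one pair [f], [f'] to the bracket. Sorting its terms by the form that
    receives [y] yields two insertions; opposite degrees give [f] and [f'] the same parity. *)
Lemma shuf_vsp_bracket Omega Omega' (f f' y : letter V) a b :
  is_cyclic gr Omega -> is_cyclic gr Omega' ->
  vanishes_on_shuffles gr Omega -> vanishes_on_shuffles gr Omega' ->
  homogeneous gr [:: f; f'; y] -> f.1 + f'.1 = 0 ->
  a != [::] -> b != [::] -> homogeneous gr (a ++ b) ->
  shuf (@odd_letter K V) a b (fun w => splits w (fun u v => sg u (rcons v y)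
    * splits (rcons v y ++ u) (fun p q =>
        Omega (rcons (unzip2 p) f.2) * Omega' (f'.2 :: unzip2 q)))) = 0.
Proof.
move=> cO cO' vO vO' /and4P[hom_f hom_f' hom_y _] deg_ff' a0 b0 hom_ab.
have par_f' : odd_letter f' = odd_letter f.
  by rewrite /odd_letter /sdeg; move: deg_ff'; lia.
pose hom := fun l : letter V => l.2 \in gr l.1.
pose W := wpar (@odd_letter K V) (a ++ b).
(* The forms need not be homogeneous, so that the sign of a term depends on the
   parity of the word inserted; h, constant on shuffle products, accounts for it. *)
pose h (p : bool) : K := (-1) ^+ (((p (+) odd_letter f) && (W (+) odd_letter y)) (+) p).
pose F w := Omega (rcons (unzip2 w) y.2).
pose F' w := Omega' (rcons (unzip2 w) y.2).
pose c w := Omega (rcons (unzip2 w) f.2).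
pose c' w := h (wpar (@odd_letter K V) w) * Omega' (rcons (unzip2 w) f'.2).
have -> : shuf (@odd_letter K V) a b (fun w => splits w (fun u v => sg u (rcons v y)
    * splits (rcons v y ++ u) (fun p q =>
        Omega (rcons (unzip2 p) f.2) * Omega' (f'.2 :: unzip2 q))))
  = shuf (@odd_letter K V) a b (insertion (@odd_letter K V) f' c F')
    + shuf (@odd_letter K V) a b (insertion (@odd_letter K V) f c' F).
  rewrite -shufD; apply: eq_shuf => w perm_w.
  have hom_w : homogeneous gr w by rewrite /homogeneous (perm_all _ perm_w).
  have par_w : wpar (@odd_letter K V) w = W := wpar_perm _ perm_w.
  (* The second insertion cuts [w] into [u1], [u2], [v]; reassociating gives it the outer cut
     [u = u1 ++ u2], [v] of the left-hand side. *)
  rewrite /insertion -[X in _ = _ + X]splits_assoc -splitsD.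
  apply: eq_splits => u v uv.
  (* A cut of [v y u] before [y] gives [y] to [Omega'], a cut after [y] gives it to [Omega]. *)
  rewrite cat_rcons splits_cat mulrDr -!splitsZ; congr (_ + _).
    apply: eq_splits => s v' sv'.
    have -> : F' (u ++ f' :: v')
        = sg u (f' :: rcons v' y) * Omega' (f'.2 :: unzip2 (v' ++ y :: u)).
      rewrite /F' -map_rcons rcons_cat rcons_cons (cyclic_cat cO').
        by rewrite cat_cons cat_rcons.
      move: hom_w; rewrite -uv -sv' /homogeneous !all_cat /= all_rcons.
      by case/and3P=> -> _ ->; rewrite hom_f' hom_y.
    suff -> : sg u (rcons v y) = sg u (f' :: s) * sg u (f' :: rcons v' y).
      by rewrite /c; ring.
    rewrite /sg -signr_addb -sv' -!cats1 !(wpar_cons, wpar_cat, wpar_nil).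
    by congr (_ ^+ nat_of_bool _); do ![case: (wpar _ _)]; do ![case: (odd_letter _)].
  apply: eq_splits => u1 u2 u12.
  have [hom_u1 hom_u2 hom_v] :
      [/\ homogeneous gr u1, homogeneous gr u2 & homogeneous gr v].
    by apply/and3P; move: hom_w; rewrite -uv -u12 /homogeneous !all_cat -andbA.
  have -> : Omega (rcons (unzip2 (v ++ y :: u1)) f.2)
      = sg (rcons v y) (rcons u1 f) * F (u1 ++ f :: v).
    rewrite -map_rcons rcons_cat rcons_cons -cat_rcons (cyclic_cat cO).
      by rewrite /F -map_rcons cat_rcons rcons_cat rcons_cons.
    rewrite /homogeneous all_cat !all_rcons hom_f hom_y.
    by move: hom_v hom_u1; rewrite /homogeneous => -> ->.
  have -> : Omega' (f'.2 :: unzip2 u2) = sg [:: f'] u2 * Omega' (rcons (unzip2 u2) f'.2).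
    rewrite -map_rcons -cats1 -(cyclic_cat cO') //.
    by rewrite /homogeneous /= hom_f'.
  suff signs : sg u (rcons v y) * sg (rcons v y) (rcons u1 f) * sg [:: f'] u2
      = sg u1 (f :: u2) * h (wpar (@odd_letter K V) u2).
    rewrite /c' (mulrA (sg u1 (f :: u2)) (h _)) -signs; ring.
  rewrite /sg /h -!signr_addb -par_w -uv -u12 -!cats1.
  rewrite !(wpar_cons, wpar_cat, wpar_nil) par_f'.
  by congr (_ ^+ nat_of_bool _); do ![case: (wpar _ _)]; do ![case: (odd_letter _)]. 
have van O z (vanO : vanishes_on_shuffles gr O) a' b' : a' != [::] -> b' != [::] ->
    all hom (a' ++ b') ->
    shuf (@odd_letter K V) a' b' (fun w => O (rcons (unzip2 w) z)) = 0.
  exact: shuf_vsp.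
rewrite (@shuf_insertion _ _ _ hom f' c F') ?(@shuf_insertion _ _ _ hom f c' F) ?addr0 //.
all: try exact: van.
(* The factor [h] in [c'] sees only the parity, so [c'] vanishes on shuffles like [Omega']. *)
by move=> a' b' a'0 b'0 hom_ab'; rewrite (shuf_par _ h) van ?mulr0.
Qed.

End Bracket.

Theorem proposition5p3 (K : fieldType) (V : vectType K) (gr : int -> {vspace V})
    (br : mform V -> mform V -> mform V) (b : {biscalar V})
    (charK : [pchar K] =i pred0) (grP : is_grading gr)
    (brP : pinczon_bracket gr br)
    (bP : quadratic_form gr b) (brb : bracket_of_form gr b br) :
  lie_subalgebra gr br (vsp_form gr).
Proof.
have [s [proj [_ proj_gr proj_sum _]]] := grading_proj grP.
split=> [Omega [] // | | k Omega Omega' [cfO vO] [cfO' vO']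
  | Omega Omega' [cfO vO] [cfO' vO']].
- split.
    split; last by exists 0%N.
      by move=> s1 s2 k x y; rewrite mulr0 addr0.
    by move=> w _; rewrite /koszul_act mulr0.
  by move=> w y p _ _; apply: big1 => sigma _; rewrite /koszul_act mulr0.
- split.
    split.
    + move=> s1 s2 a x y; rewrite /lincomb (cf_multilinear cfO) (cf_multilinear cfO').
      by ring.
    + move=> w hom_w; rewrite /koszul_act /lincomb.
      rewrite -(cf_cyclic cfO hom_w) -(cf_cyclic cfO' hom_w) /koszul_act.
      by ring.
    have [[N NO] [N' NO']] := (cf_finite cfO, cf_finite cfO').
    exists (maxn N N') => t; rewrite gtn_max => /andP[lt_N lt_N'].
    by rewrite /lincomb NO // NO' // mulr0 addr0.
  move=> w y p hom_w lt_p.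
  transitivity (
    k * \sum_(sigma in shuffles p (size w)) koszul_act (insert_last y Omega) sigma
    + \sum_(sigma in shuffles p (size w)) koszul_act (insert_last y Omega') sigma).
    rewrite big_distrr -big_split; apply: eq_bigr => sigma _ /=.
    by rewrite /koszul_act /insert_last /lincomb; ring.
  by rewrite vO // vO' // mulr0 addr0.
have cf_br := pb_closed brP cfO cfO'; split=> // w y p hom_w /andP[p_gt0 lt_p].
have [a [a' [def_w size_a a'0]]] :
    exists a a', [/\ w = a ++ a', size a = p & a' != [::]].
  exists (take p w), (drop p w); rewrite cat_take_drop size_takel 1?ltnW //.
  by rewrite -size_eq0 size_drop subn_eq0 -ltnNge.
subst w p; have a0 : a != [::] by rewrite -size_eq0 -lt0n.
rewrite sum_shuffles.
have lin_br := fun t => multilinear_last t (cf_multilinear cf_br).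
(* The formula for the bracket is given on homogeneous words, while [y] is arbitrary; hence its
   decomposition. *)
transitivity (\sum_(d <- s) shuf (@odd_letter K V) a a' (fun w =>
    br Omega Omega' (unzip2 (rcons w (d, proj d y))))).
  rewrite -shuf_sum; apply: eq_shuf => w _; rewrite /insert_last {1}[y]proj_sum.
  have [g def_g] := scalar_pack (lin_br (unzip2 w)).
  rewrite -def_g linear_sum; apply: eq_bigr => d _.
  by rewrite def_g /unzip2 map_rcons.
rewrite big1 // => d _; set l : letter V := (d, proj d y).
have [e [e' [e_basis b_ee' br_e]]] := brb.
have [cas cas_hom casE] := homogeneous_casimir grP bP e_basis b_ee'.
(* For each rotation and cut, both insertions are linear in the inserted vector, so homogeneous
   pairs of opposite degrees replace the bases. *)
transitivity (\sum_(c <- cas) shuf (@odd_letter K V) a a' (fun w =>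
  splits w (fun u v => sg K (@odd_letter K V) u (rcons v l)
    * splits (rcons v l ++ u) (fun p q =>
        Omega (rcons (unzip2 p) c.1.2) * Omega' (c.2.2 :: unzip2 q))))).
  rewrite -shuf_sum; apply: eq_shuf => w perm_w.
  rewrite br_e //; last first.
    by rewrite /homogeneous all_rcons proj_gr (perm_all _ perm_w).
  rewrite cycl_rcons -splits_sum; apply: eq_splits => u v _.
  rewrite -big_distrr; congr (_ * _); rewrite -splits_sum.
  under eq_bigr do rewrite tensor_letters.
  rewrite -splits_sum; apply: eq_splits => p q _.
  apply: (casE (fun x => Omega (rcons (unzip2 p) x)) (fun x => Omega' (x :: unzip2 q))).
    exact: (multilinear_last _ (cf_multilinear cfO)).
  exact: (multilinear_scalar [::] _ (cf_multilinear cfO')).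
rewrite big_seq big1 // => c /(allP cas_hom)/and3P[c1 c2 /eqP c12].
apply: (@shuf_vsp_bracket _ _ gr) => //; try exact: cf_cyclic.
by rewrite /homogeneous /= c1 c2 proj_gr.
Qed.
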